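(* Let $m\ge n\ge 1$ be integers, and consider the block version of musical chairs with $m$ chairs and $n$ ranked players described in the context. The map $$(S,a,z)\longmapsto (T,P)$$ constructed in the context is a bijection (one-to-one correspondence) from the set of all rejections $(S,a,z)$, over all $m^n$ samples $S$, onto the set of all matches $(T,P)$, where $T$ is a sample, $P$ is a $k'$-pattern for some $k'$ with $2\le k'\le n$, and $T$ matches $P$.
   Context: The game. There are $m$ chairs in a circle, numbered clockwise $0,\dots,m-1$ (chair arithmetic is modulo $m$), and $n$ distinguishable players, $m\ge n$, who are totally ranked in advance. A sample $S$ is an assignment of each player to a chair, his initial chair; there are $m^n$ samples. For each chair $j$, the (possibly empty) set of players with initial chair $j$ is the $j$-th block of $S$. Seating process. All blocks start simultaneously at their initial chairs and travel clockwise at the same speed, one chair per time step. Each block, as long as it is nonempty, loses exactly one member to each vacant chair it visits (including, at time $0$, its own initial chair); the member who takes the chair is the highest-ranked of the players remaining in the block. The chair at which a player is seated is his final chair. (An exhausted block is regarded as continuing to travel.) Rejections. A rejection $(S,a,z)$ consists of a sample $S$ and players $a\ne z$ such that, in the seating process for $S$, player $a$ (travelling with his block) visits the final chair of $z$ strictly before $a$ reaches his own final chair, and finds it occupied by $z$ (possibly $z$ is a member of $a$'s own block who has just taken that chair). Patterns and matches. A sub-sample of $k'$ of the $n$ players is an assignment of those $k'$ players to chairs. A sample $S$ matches a sub-sample $P$ if every member of the $j$-th block of $P$ is a member of the $j$-th block of $S$, for $j=0,\dots,m-1$. For $k'\ge2$, a $k'$-pattern is a sub-sample of $k'$ players having,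 for some chair $c$, a block of two players at chair $c$, one block of exactly one player at each of the chairs $c+1,\dots,c+k'-2$ (mod $m$), and no other nonempty blocks. A match is a pair $(T,P)$ with $T$ a sample, $P$ a pattern and $T$ matching $P$. The map. Given a rejection $(S,a,z)$, define distinguished blocks $b_1,\dots,b_k$ of $S$ and players $p_1,\dots,p_k$ as follows. $b_1$ is the block containing $a$; let $c$ be its initial chair. Given $b_i$: (1) if $b_i$ contains $z$, stop, set $k=i$ and $p_k=z$; (2) otherwise, let $d_i$ be the last chair to which $b_i$ lost a member before $b_i$ (possibly exhausted) encountered $z$'s final chair, let $p_i$ be the member lost at $d_i$, and let $b_{i+1}$ be the block whose initial chair is $d_i+1$. The sample $T$ is obtained from $S$ by permuting the blocks with respect to the chairs: $b_1,b_2,\dots,b_k$ are placed at chairs $c,c+1,\dots,c+k-1$ respectively, and the $m-k$ undistinguished blocks (including empty ones) occupy the remaining chairs $c+k,\dots,c+m-1$ in the same relative order in which they occur in $S$ reading clockwise from $c$. The $(k+1)$-pattern $P$ assigns $a$ to chair $c$ and, for $1\le i\le k$, assigns $p_i$ to chair $c+i-1$. *)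

(* Defs.v *)
From mathcomp Require Import all_boot all_fingroup.

Set Implicit Arguments.
Unset Strict Implicit.
Unset Printing Implicit Defensive.

(* Chairs are 'I_m, with the clockwise successor [ordS] (addition of 1 modulo *)
(* m); players are 'I_n, ranked by a permutation [rk : 'S_n]: rk p is the     *)
(* position of p in the ranking, 0 being the highest.                         *)

Definition sample (m n : nat) := {ffun 'I_n -> 'I_m}.

(* [None] on the players that the sub-sample leaves out.                      *)
Definition subsample (m n : nat) := {ffun 'I_n -> option 'I_m}.

(* A block is designated by its initial chair.                                *)
Definition block m n (S : sample m n) (j : 'I_m) : {set 'I_n} :=
  [set p | S p == j].

Definition subblock m n (P : subsample m n) (j : 'I_m) : {set 'I_n} :=
  [set p | P p == Some j].

(* The chair j + t, and the chair j - t, modulo m.                            *)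
Definition ahead m (j : 'I_m) (t : nat) : 'I_m := iter t (@ordS m) j.
Definition behind m (j : 'I_m) (t : nat) : 'I_m := iter t (@ord_pred m) j.

(* The least t such that ahead j t = x.                                       *)
Definition cdist m (j x : 'I_m) : nat := (x + m - j) %% m.

(* ---- Seating process ----------------------------------------------------- *)

(* The occupant of each chair, if any.                                        *)
Definition occupancy (m n : nat) := {ffun 'I_m -> option 'I_n}.

Definition is_seated m n (o : occupancy m n) (p : 'I_n) : bool :=
  [exists x, o x == Some p].

Definition highest n (rk : 'S_n) (A : {set 'I_n}) : option 'I_n :=
  [pick p in A | [forall q in A, rk p <= rk q]].

(* The members of the block from chair j who are not seated yet.              *)
Definition remaining m n (S : sample m n) (o : occupancy m n) (j : 'I_m) :
    {set 'I_n} :=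
  [set p in block S j | ~~ is_seated o p].

(* [occ rk S t] is the occupancy just before time t, that is after the steps  *)
(* 0, ..., t - 1.  The block that is at chair x at time t is the one from     *)
(* chair x - t, so that no two blocks ever meet.                              *)
Fixpoint occ m n (rk : 'S_n) (S : sample m n) (t : nat) : occupancy m n :=
  if t is t'.+1 then
    [ffun x => if occ rk S t' x is Some p then Some p
               else highest rk (remaining S (occ rk S t') (behind x t'))]
  else [ffun=> None].

(* After the m steps 0, ..., m - 1 every block has visited every chair, hence *)
(* all players are seated (when n <= m); nobody moves once seated.            *)
Definition final_chair m n (rk : 'S_n) (S : sample m n) (p : 'I_n) :
    option 'I_m :=
  [pick x | occ rk S m x == Some p].

(* The member, if any, that the block from chair j loses at time t, to the    *)
(* chair j + t: only this block is at that chair at that time.                *)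
Definition loss m n (rk : 'S_n) (S : sample m n) (j : 'I_m) (t : nat) :
    option 'I_n :=
  if occ rk S t (ahead j t) is Some _ then None
  else occ rk S t.+1 (ahead j t).

(* ---- Rejections ---------------------------------------------------------- *)

(* At some time t, a visits the final chair of z, finds it occupied by z      *)
(* (possibly since that very time t), and is still unseated after step t.     *)
(* Players are seated at times < m, so that it is enough to consider t < m.   *)
Definition is_rejection m n (rk : 'S_n) (S : sample m n) (a z : 'I_n) : bool :=
  (a != z) &&
  [exists t : 'I_m, [&& final_chair rk S z == Some (ahead (S a) t),
                        occ rk S t.+1 (ahead (S a) t) == Some z
                      & ~~ is_seated (occ rk S t.+1) a]].

Definition rejections m n (rk : 'S_n) : {set sample m n * 'I_n * 'I_n} :=
  [set r | is_rejection rk r.1.1 r.1.2 r.2].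

(* ---- Matches ------------------------------------------------------------- *)

(* The sequence traject (@ordS m) (ordS c) (k - 2) is c + 1, ..., c + k - 2.  *)
Definition is_pattern m n (k : nat) (P : subsample m n) : bool :=
  [&& 2 <= k, #|[set p | P p]| == k &
   [exists c : 'I_m, [forall j : 'I_m,
      #|subblock P j| == (if j == c then 2
                          else (j \in traject (@ordS m) (ordS c) (k - 2))%N)]]].

Definition sample_matches m n (T : sample m n) (P : subsample m n) : bool :=
  [forall j, subblock P j \subset block T j].

Definition matches m n : {set sample m n * subsample m n} :=
  [set q | [exists k : 'I_n.+1, is_pattern k q.2] && sample_matches q.1 q.2].

(* ---- The map ------------------------------------------------------------- *)

(* The last chair d to which the block from chair j lost a member at a time   *)
(* < e, together with that member.                                            *)
Fixpoint last_loss m n (rk : 'S_n) (S : sample m n) (j : 'I_m) (e : nat) :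
    option ('I_m * 'I_n) :=
  if e is t.+1 then
    if loss rk S j t is Some p then Some (ahead j t, p)
    else last_loss rk S j t
  else None.

(* The sequence (b_1, p_1), ..., (b_k, p_k), where b_1 is the block from      *)
(* chair j and fz is the final chair of z; a block b_i encounters fz at time  *)
(* cdist b_i fz.  The value is None if some d_i does not exist or if no block *)
(* containing z is reached.  As b_{i+1} is a function of b_i, the blocks are  *)
(* distinct if one containing z is reached, so that fuel m is enough.         *)
Fixpoint distinguished m n (rk : 'S_n) (S : sample m n) (z : 'I_n) (fz : 'I_m)
    (fuel : nat) (j : 'I_m) : option (seq ('I_m * 'I_n)) :=
  if j == S z then Some [:: (j, z)]
  else if fuel is fuel'.+1 then
    if last_loss rk S j (cdist j fz) is Some (d, p) then
      omap (cons (j, p)) (distinguished rk S z fz fuel' (ordS d))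
    else None
  else None.

(* The blocks of S in their clockwise order from chair c in T.                *)
Definition block_order m (c : 'I_m) (bs : seq 'I_m) : seq 'I_m :=
  bs ++ [seq x <- traject (@ordS m) c m | x \notin bs].

Definition rearrange m n (S : sample m n) (c : 'I_m) (bs : seq 'I_m) :
    sample m n :=
  [ffun p => ahead c (index (S p) (block_order c bs))].

(* The sub-sample assigning a to c, and the i-th entry of ps (from 0) to the  *)
(* chair c + i.                                                               *)
Definition make_pattern m n (c : 'I_m) (a : 'I_n) (ps : seq 'I_n) :
    subsample m n :=
  [ffun q => if q == a then Some c
             else if q \in ps then Some (ahead c (index q ps)) else None].

(* The pair (T, P); None if the construction breaks down.                     *)
Definition rejection_map m n (rk : 'S_n) (r : sample m n * 'I_n * 'I_n) :
    option (sample m n * subsample m n) :=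
  let: (s, a, z) := r in
  if final_chair rk s z is Some fz then
    if distinguished rk s z fz m (s a) is Some bps then
      Some (rearrange s (s a) (unzip1 bps), make_pattern (s a) a (unzip2 bps))
    else None
  else None.

(* Main.v *)
Require Import Defs.
From mathcomp Require Import all_boot all_fingroup.
From mathcomp Require Import zify.

Set Implicit Arguments.
Unset Strict Implicit.
Unset Printing Implicit Defensive.

(** Read the circle as a cyclic word of brackets: at each chair, one opening
    bracket per member of its block, the lowest-ranked first, followed by one
    closing bracket for the chair.  A vacant chair is taken by the nearest
    preceding block that still has members, and within it by the highest-ranked
    of them, so that seating is the matching of brackets (occP).  With
    [load u] the number of players in the blocks of the list [u], and [depth p]
    the number of lower-ranked members of the block of [p], the bracket of [p]
    is closed by the end of the shortest list [u] of consecutive chairs, from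
    the chair of [p] on, such that [load u = depth p + size u] (closes).

    A rejection (S, a, z) is then a pair of nested brackets, that of [a]
    outside that of [z] (rejectionP), and the construction walks from [a] to
    [z]: unless [z] is in the block of [a], [p_1] is the member of that block
    whose bracket is the last to close before the final chair of [z], the next
    block opens on the next chair, and so on (chain).  Conversely a chain that starts with a player [p]
    of higher rank in the block of [a] does give a rejection by [a] of its last
    player, since no prefix of the word falls below the level of [p] before
    that player is seated (chain_floor, linked_rejection).

    A match (T, P) amounts to a sample [T], a player [a] and a list
    [p_1], ..., [p_k] whose blocks stand on consecutive chairs, [p_1] being in
    the block of [a] and ranked above him (match_marking, marking_inj).  What
    the map forgets is how the undistinguished blocks were interleaved with the
    distinguished ones.  This is recovered by reading the undistinguished
    blocks after [b_1] until the bracket of [p_1] closes, then opening [b_2],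
    and so on (spliced).  The stopping places are forced, which gives
    injectivity (spliced_inj); they exist because there are no more players
    than chairs, which gives surjectivity (spliced_exists).  Both sizes of
    blocks and depths are unchanged when blocks are moved as wholes, so the
    reading may be done in T as well as in S (relabel_spliced). *)

#[local] Arguments ahead : simpl never.

(** * The circle of chairs *)

Section Circle.

Variable m : nat.
Implicit Types (c j x : 'I_m) (s t e : nat).

Lemma aheadE j t : ahead j t = (j + t) %% m :> nat.
Proof.
elim: t => [|t IHt]; first by rewrite addn0 modn_small.
by rewrite /ahead iterS /= -/(ahead j t) IHt -addn1 modnDml addn1 addnS.
Qed.

Lemma aheadD j s t : ahead j (s + t) = ahead (ahead j s) t.
Proof. by apply: ord_inj; rewrite !aheadE modnDml addnA. Qed.

Lemma aheadS j t : ahead j t.+1 = ordS (ahead j t).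
Proof. by []. Qed.

Lemma ahead_inj t : injective (@ahead m ^~ t).
Proof. by elim: t => [|t IHt] x y //= /ordS_inj /IHt. Qed.

Lemma aheadI j s t : s < m -> t < m -> ahead j s = ahead j t -> s = t.
Proof.
move=> ltsm lttm /(congr1 val)/eqP; rewrite /= !aheadE eqn_modDl.
by rewrite !modn_small // => /eqP.
Qed.

Lemma behindK x t : ahead (behind x t) t = x.
Proof.
elim: t x => // t IHt x.
by rewrite aheadS -[RHS](ord_predK x) -[ord_pred x in RHS](IHt) /behind -iterSr.
Qed.

Lemma behind_ahead j t : behind (ahead j t) t = j.
Proof. by apply: (@ahead_inj t); rewrite behindK. Qed.

Lemma cdist_lt j x : cdist j x < m.
Proof. by rewrite ltn_mod; case: m j => [[]|]. Qed.

Lemma ahead_cdist j x : ahead j (cdist j x) = x.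
Proof.
apply: ord_inj; rewrite aheadE /cdist modnDmr subnKC ?modnDr ?modn_small //.
by rewrite (leq_trans (ltnW (ltn_ord j))) ?leq_addl.
Qed.

Lemma cdist_ahead j t : t < m -> cdist j (ahead j t) = t.
Proof.
by move=> lttm; apply: (@aheadI j) => //; rewrite ?cdist_lt ?ahead_cdist.
Qed.

(** The [t] chairs from [c] on, clockwise. *)
Definition arc c t : seq 'I_m := traject (@ordS m) c t.

Lemma arcD c s t : arc c (s + t) = arc c s ++ arc (ahead c s) t.
Proof. exact: trajectD. Qed.

Lemma arc_uniq c t : t <= m -> uniq (arc c t).
Proof.
move=> letm; apply/(uniqP c) => i j; rewrite !inE size_traject => lti ltj.
rewrite !nth_traject //; apply: aheadI; exact: leq_trans letm.
Qed.

Lemma mem_arc c x : x \in arc c m.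
Proof.
apply/trajectP; exists (cdist c x); first exact: cdist_lt.
by rewrite -/(ahead c _) ahead_cdist.
Qed.

Lemma index_arc c t e : e < t -> t <= m -> index (ahead c e) (arc c t) = e.
Proof.
move=> ltet letm; have := @index_uniq _ c e (arc c t).
by rewrite size_traject nth_traject //; apply => //; apply: arc_uniq.
Qed.

Lemma index_arcK c x : ahead c (index x (arc c m)) = x.
Proof.
by rewrite -{1}(ahead_cdist c x) index_arc ?ahead_cdist ?cdist_lt.
Qed.

End Circle.

Section Load.

Variables (m n : nat) (S : sample m n).
Implicit Types (u : seq 'I_m) (c j x : 'I_m) (s t : nat).

(** The same chair may occur several times in [u]; it is then counted as many
    times. *)
Definition load u : nat := \sum_(x <- u) #|block S x|.

Lemma load_cat u1 u2 : load (u1 ++ u2) = load u1 + load u2.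
Proof. exact: big_cat. Qed.

Lemma load_cons x u : load (x :: u) = #|block S x| + load u.
Proof. exact: big_cons. Qed.

Lemma load_arcD c s t :
  load (arc c (s + t)) = load (arc c s) + load (arc (ahead c s) t).
Proof. by rewrite arcD load_cat. Qed.

Lemma load_arc1 c : load (arc c 1) = #|block S c|.
Proof. exact: big_seq1. Qed.

Lemma load_arcS c t :
  load (arc c t.+1) = load (arc c t) + #|block S (ahead c t)|.
Proof. by rewrite -addn1 load_arcD load_arc1. Qed.

Lemma load_all u : uniq u -> (forall x, x \in u) -> load u = n.
Proof.
move=> Uu allu; rewrite /load big_uniq //= -[RHS]card_ord -sum1_card.
rewrite (partition_big S [in u]) //=.
by apply: eq_bigr => x _; rewrite -sum1_card; apply: eq_bigl => p; rewrite inE.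
Qed.

Lemma load_circle c : load (arc c m) = n.
Proof. by apply: load_all => [|x]; rewrite ?arc_uniq ?mem_arc. Qed.

End Load.

(** * Depth of a player and the time he is seated *)

Section Depth.

Variables (m n : nat) (rk : 'S_n) (S : sample m n).
Implicit Types (u : seq 'I_m) (c j x : 'I_m) (p q : 'I_n) (s t v : nat).

Definition depth p : nat := #|[set q in block S (S p) | rk p < rk q]|.

Lemma depth_lt p : depth p < #|block S (S p)|.
Proof.
apply: proper_card; apply/properP; split.
  by apply/subsetP => q; rewrite inE => /andP[].
by exists p; rewrite !inE ?eqxx ?ltnn.
Qed.

Lemma depth_le p q : S p = S q -> (depth q <= depth p) = (rk p <= rk q).
Proof.
have main p' q' : S p' = S q' -> rk p' <= rk q' -> depth q' <= depth p'.
  move=> eqS le_pq; apply/subset_leq_card/subsetP => r; rewrite !inE eqS.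
  by case/andP=> -> /(leq_ltn_trans le_pq).
move=> eqS; apply/idP/idP; last exact: main.
apply: contraTT; rewrite -!ltnNge => lt_qp; apply: proper_card.
apply/properP; split.
  by apply/subsetP => r; rewrite !inE eqS => /andP[-> /(ltn_trans lt_qp)].
by exists p; rewrite !inE ?eqS ?eqxx ?ltnn.
Qed.

Lemma depth_inj p q : S p = S q -> depth p = depth q -> p = q.
Proof.
move=> eqS eqd; apply/(@perm_inj _ rk)/val_inj/eqP.
by rewrite /= eqn_leq -!depth_le // eqd leqnn.
Qed.

Lemma depth_surj j v : v < #|block S j| -> exists2 p, S p = j & depth p = v.
Proof.
move=> ltv; pose D := [seq depth p | p in block S j].
have UD : uniq D.
  rewrite map_inj_in_uniq ?enum_uniq // => p q; rewrite !mem_enum !inE.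
  by move=> /eqP Sp /eqP Sq; apply: depth_inj; rewrite Sp Sq.
have sD : {subset D <= iota 0 #|block S j|}.
  move=> _ /imageP[p + ->]; rewrite mem_iota inE => /eqP Sp.
  by rewrite /= add0n -Sp depth_lt.
have [|_ eqD] := uniq_min_size UD sD; first by rewrite size_iota size_image.
have: v \in D by rewrite eqD mem_iota.
by case/imageP=> p; rewrite inE => /eqP Sp ->; exists p.
Qed.

(** The bracket of [p] is closed exactly at the end of [u], a list of chairs
    that starts with his own: each prefix has [size] closing brackets, and the
    surplus of opening ones first drops to [depth p], the number of brackets of
    his block that lie outside his, at the end.  The list need not be made of
    consecutive chairs, as other orders of the blocks are considered too. *)
Definition closes p u : Prop :=
  load S u = depth p + size u /\
  forall i, 0 < i < size u -> depth p + i < load S (take i u).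

(** That [p] is seated at time [t] in the process is shown in [occP]. *)
Definition seats p t : Prop := closes p (arc (S p) t.+1).

Lemma seatsP p t :
  seats p t <-> load S (arc (S p) t.+1) = depth p + t.+1 /\
    forall i, 0 < i <= t -> depth p + i < load S (arc (S p) i).
Proof.
rewrite /seats /closes size_traject.
split=> -[eqL ltL]; split=> // i iP; have := ltL i;
by rewrite /arc take_traject; [apply | case/andP: iP => _; lia].
Qed.

Lemma seats_le p t i : seats p t -> 0 < i <= t.+1 ->
  depth p + i <= load S (arc (S p) i).
Proof.
move=> /seatsP[eqL ltL] /andP[i_gt0]; rewrite leq_eqVlt => /predU1P[->|].
  by rewrite eqL.
by rewrite ltnS => leit; apply/ltnW/ltL; rewrite i_gt0.
Qed.

(** Lengthening a list of chairs by one lowers its load relative to its length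
    by at most one, so that the first prefix whose load is at most [depth p]
    above its length has exactly that load. *)
Lemma closes_exists p l : load S (S p :: l) <= depth p + (size l).+1 ->
  exists2 i, i <= size l & closes p (S p :: take i l).
Proof.
move=> leL.
pose P i := (i <= size l) && (load S (S p :: take i l) <= depth p + i.+1).
have exP : exists i, P i by exists (size l); rewrite /P leqnn take_size.
case: (ex_minnP exP) => i /andP[lei Pi] mini; exists i => //.
have lt_before k : 0 < k <= i -> depth p + k < load S (take k (S p :: take i l)).
  case: k => // k /= ltk; rewrite take_takel ?(ltnW ltk) // ltnNge; apply/negP => Pk.
  by have := mini k; rewrite /P Pk (leq_trans (ltnW ltk)) // leqNgt ltk => /(_ isT).
split=> [|k]; rewrite /= size_takel //; last by move=> ?; apply: lt_before.
apply/eqP; rewrite eqn_leq Pi /=.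
case: i lei lt_before {Pi mini} => [_ _|i lei lt_before].
  by rewrite take0 addn1 (leq_trans (depth_lt p)) // load_cons leq_addr.
have /= := lt_before i.+1; rewrite ltnSn take_takel // => /(_ isT) ltL.
rewrite addnS (leq_trans ltL) //.
by rewrite (take_nth (S p)) // -cats1 -cat_cons [X in _ <= X]load_cat leq_addr.
Qed.

Lemma seats_exists p t : load S (arc (S p) t.+1) <= depth p + t.+1 ->
  exists2 t', t' <= t & seats p t'.
Proof.
move=> leL; have [|i] := @closes_exists p (arc (ordS (S p)) t).
  by rewrite size_traject.
by rewrite size_traject => leit; rewrite take_traject //; exists i.
Qed.

Lemma seats_unique p t1 t2 : seats p t1 -> seats p t2 -> t1 = t2.
Proof.
have main t t' : seats p t -> seats p t' -> t' <= t.
  move=> /seatsP[eqL _] /seatsP[_ ltL]; rewrite leqNgt; apply/negP => lt_tt'.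
  by have := ltL t.+1 lt_tt'; rewrite eqL ltnn.
by move=> s1 s2; apply/eqP; rewrite eqn_leq !main.
Qed.

Lemma seats_exists_lt p : n <= m -> exists2 t, t < m & seats p t.
Proof.
move=> lenm; have m_gt0 : 0 < m by case: m (S p) => [[]|].
have [|t let_m st] := @seats_exists p m.-1.
  by rewrite prednK // load_circle (leq_trans lenm) ?leq_addl.
by exists t; rewrite // -(prednK m_gt0).
Qed.

(** The chairs spanned by the bracket of [q] hold at least as many players as
    there are chairs.  Were the bracket of [p] closed at the same chair, its
    surplus would have dropped to [depth p] before the block of [q]. *)
Lemma seats_clash p q s t : S q = ahead (S p) s -> 0 < s ->
  seats q t -> ~ seats p (s + t).
Proof.
move=> Sq s_gt0 /seatsP[eqLq _] /seatsP[eqLp ltLp].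
have := ltLp s; rewrite s_gt0 leq_addr => /(_ isT).
by move: eqLp; rewrite -addnS load_arcD -Sq eqLq; lia.
Qed.

(** When an arc holds more players than it has chairs before its last one, that
    last chair closes a bracket opened in the arc: it belongs to the first
    block, going backwards, from which on this inequality holds. *)
Lemma chair_taken j t : t < load S (arc j t.+1) ->
  exists i p t', [/\ t = i + t', S p = ahead j i, seats p t'
    & i = 0 -> depth p + t.+1 = load S (arc j t.+1)].
Proof.
move=> ltL.
pose P l := (l <= t) && (l < load S (arc (ahead j (t - l)) l.+1)).
have exP : exists l, P l by exists t; rewrite /P subnn leqnn.
case: (ex_minnP exP) => l /andP[lelt ltl] minl.
have [b bE] : exists b, b = ahead j (t - l) by exists (ahead j (t - l)).
rewrite -bE in ltl.
have shorter i : 0 < i <= l -> load S (arc (ahead b i) (l.+1 - i)) <= l - i.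
  move=> /andP[i_gt0 leil]; rewrite leqNgt; apply/negP => lti.
  have : P (l - i).
    rewrite /P (leq_trans (leq_subr _ _) lelt) /=.
    move: lti; rewrite bE -aheadD (_ : t - l + i = t - (l - i)); last by lia.
    by rewrite subSn.
  by move=> /minl; lia.
have split_at i : 0 < i <= l.+1 ->
  load S (arc b l.+1) = load S (arc b i) + load S (arc (ahead b i) (l.+1 - i)).
  by move=> /andP[_ lei]; rewrite -load_arcD subnKC.
have [|p Sp dp] := @depth_surj b (load S (arc b l.+1) - l.+1).
  rewrite -(load_arc1 S b).
  case: (posnP l) => [l0|l_gt0]; first by move: ltl; rewrite l0; lia.
  have := shorter 1 l_gt0; have := split_at 1 isT.
  by lia.
exists (t - l), p, l; split; [by lia | by rewrite Sp bE | |].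
  apply/seatsP; rewrite Sp; split; first by rewrite dp subnK.
  move=> i iP; rewrite dp.
  (* minimality of l, applied to the arc that starts i chairs later *)
  have /andP[i_gt0 lei] := iP.
  have leiS: 0 < i <= l.+1 by rewrite i_gt0 ltnW.
  have := shorter i iP; have := split_at i leiS; lia.
move=> tl0; have {tl0} eqlt : l = t by lia.
rewrite dp; move: ltl; rewrite bE eqlt subnn => ltl.
by rewrite subnK.
Qed.

End Depth.

(** * The seating process is the matching of brackets *)

Section Process.

Variables (m n : nat) (rk : 'S_n) (S : sample m n).
Implicit Types (c j x d : 'I_m) (p q a z : 'I_n) (s t e : nat).

Local Notation seats := (seats rk S).
Local Notation depth := (depth rk S).

Lemma highestP (A : {set 'I_n}) p :
  highest rk A = Some p <-> p \in A /\ {in A, forall q, rk p <= rk q}.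
Proof.
rewrite /highest; case: pickP => [q /andP[qA /forall_inP minq] | noq].
  split=> [[<-] // | [pA minp]]; congr Some; apply/(@perm_inj _ rk)/ord_inj.
  by apply/eqP; rewrite eqn_leq minq // minp.
split=> // -[pA minp]; have /negP[] := negbT (noq p).
by rewrite /= pA; apply/forall_inP.
Qed.

(** The state of the chairs just before time [t], as told by the brackets. *)
Definition settled t x p : Prop :=
  exists t', [/\ t' < t, seats p t' & x = ahead (S p) t'].

Lemma settled_unique t x p q : settled t x p -> settled t x q -> p = q.
Proof.
move=> [t1 [_ s1 x1]] [t2 [_ s2 x2]].
wlog le12 : p q t1 t2 s1 s2 x1 x2 / t1 <= t2.
  case: (leqP t1 t2) => [le12 | /ltnW le21] wlg; first exact: (wlg _ _ t1 t2).
  by apply: esym; apply: (wlg _ _ t2 t1).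
have Sp : S p = ahead (S q) (t2 - t1).
  by apply: (@ahead_inj _ t1); rewrite -x1 -aheadD subnK.
have [lt12 | ge12] := ltnP t1 t2.
  have s_gt0 : 0 < t2 - t1 by rewrite subn_gt0.
  by case: (seats_clash Sp s_gt0 s1); rewrite subnK.
have eq12 : t1 = t2 by apply/eqP; rewrite eqn_leq le12.
have {}Sp : S p = S q by rewrite Sp eq12 subnn.
rewrite {}eq12 in s1.
apply: (@depth_inj _ _ rk S) => //.
have /seatsP[+ _] := s1; have /seatsP[+ _] := s2.
by rewrite -Sp => -> /addIn.
Qed.

(** The step at time [t], when the block from [j] finds the chair [ahead j t]
    vacant: the highest-ranked player left is then the one whose bracket the
    chair closes. *)
Lemma vacant_seats j t p :
    (forall q t', t' < t -> seats q t' -> ahead j t <> ahead (S q) t') ->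
  (S p = j /\ seats p t) <->
  [/\ S p = j, forall t', t' < t -> ~ seats p t'
    & forall q, S q = j -> (forall t', t' < t -> ~ seats q t') ->
      rk p <= rk q].
Proof.
move=> vacant.
have unseated_load q : S q = j -> (forall t', t' < t -> ~ seats q t') ->
    depth q + t.+1 <= load S (arc j t.+1).
  move=> <- noq; rewrite leqNgt; apply/negP => ltL.
  case: t noq ltL {vacant} => [|t] noq ltL.
    by move: ltL; rewrite load_arc1 addn1 ltnS leqNgt depth_lt.
  have [|t' let' st'] := @seats_exists _ _ rk S q t; last by case: (noq t').
  by move: ltL; rewrite load_arcS addnS ltnS; apply: leq_trans (leq_addr _ _).
split=> [[Sp sp] | [Sp nop minp]].
  split=> // [t' ltt' /(seats_unique sp) eqt | q Sq noq].
    by rewrite eqt ltnn in ltt'.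
  rewrite -(@depth_le _ _ rk S) ?Sp ?Sq // -(leq_add2r t.+1).
  by have /seatsP[<- _] := sp; rewrite Sp; apply: unseated_load.
split=> //; have leL := unseated_load p Sp nop.
have [|i [q [t' [eqt Sq sq eqL]]]] := @chair_taken _ _ rk S j t.
  by apply: leq_trans leL; rewrite leq_addl.
have i0 : i = 0.
  apply/eqP; rewrite -leqn0 leqNgt; apply/negP => i_gt0.
  by case: (vacant q t') => //; rewrite ?Sq -?aheadD -?eqt //; lia.
subst i; rewrite add0n in eqt; subst t'; have {}eqL := eqL erefl.
rewrite -[ahead j 0]/j in Sq.
suff -> : p = q by [].
apply: (@depth_inj _ _ rk S); rewrite ?Sp ?Sq //; apply/eqP.
rewrite eqn_leq -(leq_add2r t.+1) eqL leL /= depth_le ?Sp ?Sq //.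
apply: minp => // t' ltt' /(seats_unique sq) eqt.
by rewrite eqt ltnn in ltt'.
Qed.

(** By induction on time, the seating process is the matching of brackets. *)
Lemma occP t x p : t <= m -> occ rk S t x = Some p <-> settled t x p.
Proof.
elim: t x p => [|t IHt] x p letm.
  by rewrite ffunE; split=> // -[t' []].
have {}IHt := IHt _ _ (ltnW letm).
have seatedP q : is_seated (occ rk S t) q <-> exists2 t', t' < t & seats q t'.
  split=> [/existsP[y /eqP/IHt[t' [ltt' st' _]]] | [t' ltt' st']].
    by exists t'.
  by apply/existsP; exists (ahead (S q) t'); apply/eqP/IHt; exists t'.
have widen y q : settled t y q -> settled t.+1 y q.
  by case=> t' [/ltnW ? ? ?]; exists t'.
rewrite ffunE; case Ex: (occ rk S t x) => [q|].
  have sq : settled t.+1 x q by apply/widen/IHt.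
  by split=> [[<-] // | sp]; congr Some; apply: settled_unique sq sp.
have vacant q t' : t' < t -> seats q t' ->
    ahead (behind x t) t <> ahead (S q) t'.
  move=> ltt' st'; rewrite behindK => eqx.
  by have: occ rk S t x = Some q by [apply/IHt; exists t']; rewrite Ex.
have remP q : q \in remaining S (occ rk S t) (behind x t) <->
    S q = behind x t /\ forall t', t' < t -> ~ seats q t'.
  rewrite !inE; split=> [/andP[/eqP -> /negP nos] | [-> noq]].
    by split=> // t' ltt' sq; apply/nos/seatedP; exists t'.
  by rewrite eqxx; apply/negP => /seatedP[t' /noq].
have settledSP : settled t.+1 x p <-> S p = behind x t /\ seats p t.
  split=> [[t' [ltt' st' eqx]] | [Sp st]].
    move: ltt'; rewrite ltnS leq_eqVlt => /predU1P[eqt | ltt'].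
      by rewrite eqx eqt behind_ahead -eqt.
    by case: (vacant p t'); rewrite ?behindK.
  by exists t; rewrite ltnS leqnn Sp behindK.
apply: (iff_trans (highestP _ _)); apply: iff_sym.
apply: (iff_trans settledSP); apply: (iff_trans (vacant_seats _ vacant)).
split=> [[Sp nop minp] | [/remP[Sp nop] minp]].
  by split=> [|q /remP[Sq noq]]; [apply/remP | apply: minp].
by split=> // q Sq noq; apply/minp/remP.
Qed.

Lemma seatedP t p : t <= m ->
  reflect (exists2 t', t' < t & seats p t') (is_seated (occ rk S t) p).
Proof.
move=> letm; apply: (iffP existsP) => [[x /eqP/(occP _ _ letm)] | [t' ltt' st']].
  by case=> t' [? ? _]; exists t'.
exists (ahead (S p) t'); apply/eqP/occP => //; by exists t'.
Qed.

Lemma final_chairP p x :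
  final_chair rk S p = Some x <-> exists2 t, t < m & seats p t /\ x = ahead (S p) t.
Proof.
rewrite /final_chair; case: pickP => [y /eqP/(occP _ _ (leqnn m)) | nox].
  case=> t [lttm st ->]; split=> [[<-] | [t' _ [st' ->]]]; first by exists t.
  by rewrite (seats_unique st st').
split=> // -[t lttm [st eqx]]; have /negP[] := negbT (nox x).
by apply/eqP/occP => //; exists t.
Qed.

Lemma lossP j t p : t < m -> loss rk S j t = Some p <-> S p = j /\ seats p t.
Proof.
move=> lttm; rewrite /loss; split=> [|[<- st]].
  case Ex: (occ _ _ _ _) => [//|] /(occP _ _ lttm)[t' [+ st' eqx]].
  rewrite ltnS leq_eqVlt => /predU1P[eqt | ltt'].
    by subst t'; have := ahead_inj eqx.
  have : occ rk S t (ahead j t) = Some p by apply/occP; [lia | exists t'].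
  by rewrite Ex.
case Ex: (occ _ _ _ _) => [q|]; last by apply/occP => //; exists t.
have /(occP _ _ (ltnW lttm))[t' [ltt' st' eqx]] := Ex.
have spS : settled m (ahead (S p) t) p by exists t.
have sqS : settled m (ahead (S p) t) q by exists t'; split=> //; apply: ltn_trans lttm.
have eqpq := settled_unique spS sqS; subst q.
by rewrite (seats_unique st st') ltnn in ltt'.
Qed.

(** A rejection is a pair of nested brackets: at the time [e + tz] at which
    the block of [a] meets the final chair of [z], it is occupied because it
    was [e] chairs nearer to [z], and [a] is still travelling. *)
Lemma rejectionP a z : n <= m ->
  is_rejection rk S a z <-> exists e tz ta,
   [/\ seats z tz, seats a ta, ta < m, S z = ahead (S a) e & e + tz < ta].
Proof.
move=> lenm; split.
  case/andP=> ne_az /existsP[t /and3P[/eqP/final_chairP[tz lttz [sz eqx]]]].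
  move=> /eqP/(occP _ _ (ltn_ord t))[tz' [lttz' sz' _]].
  move=> /(seatedP _ (ltn_ord t)) nosa.
  rewrite -{}(seats_unique sz sz') {tz' sz'} in lttz'.
  have [ta lttam sa] := @seats_exists_lt _ _ rk S a lenm.
  have ltta : t < ta.
    by rewrite ltnNge; apply/negP => leta; apply: nosa; exists ta.
  exists (t - tz), tz, ta; split=> //; last by lia.
  apply: (@ahead_inj _ tz); rewrite -eqx -aheadD subnK //.
case=> [e [tz [ta [sz sa ltta Sz lt_e]]]]; apply/andP; split.
  apply: contraTneq (lt_e) => eqaz; subst z.
  by rewrite (seats_unique sz sa) -leqNgt leq_addl.
have lt_etzm : e + tz < m by apply: ltn_trans ltta.
have eqch : ahead (S a) (Ordinal lt_etzm) = ahead (S z) tz.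
  by rewrite aheadD Sz.
apply/existsP; exists (Ordinal lt_etzm); rewrite eqch; apply/and3P; split.
- by apply/eqP/final_chairP; exists tz => //; lia.
- by apply/eqP/occP => //; exists tz; split=> //; rewrite ltnS leq_addl.
apply/(seatedP _ lt_etzm) => -[ta' lt_ta' /(seats_unique sa) eqta].
by move: lt_ta'; rewrite -eqta ltnS leqNgt lt_e.
Qed.

Lemma last_loss_seats j e t p : e <= m -> t < e -> S p = j -> seats p t ->
    (forall q t', t < t' < e -> S q = j -> ~ seats q t') ->
  last_loss rk S j e = Some (ahead j t, p).
Proof.
move=> leem + Sp sp; elim: e leem => // e IHe leem; rewrite ltnS.
rewrite leq_eqVlt => /predU1P[eqt _ | ltte nolater] /=.
  by subst e; have /lossP -> : S p = j /\ seats p t by [].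
case El: (loss rk S j e) => [q|].
  by have /(lossP _ _ leem)[Sq /nolater[]] := El; rewrite // ltte /=.
apply: IHe => // [|q t' /andP[ltt' /ltnW lte]]; first exact: ltnW.
by apply: nolater; rewrite ltt'.
Qed.

End Process.

(** * Chains of brackets *)

Section Chain.

Variables (m n : nat) (rk : 'S_n) (S : sample m n).
Implicit Types (u w r : seq 'I_m) (c j x : 'I_m) (p q a z : 'I_n).
Implicit Types (ps : seq 'I_n) (s t e i : nat).

Local Notation seats := (seats rk S).
Local Notation depth := (depth rk S).
Local Notation closes := (closes rk S).

(** The players [p_1], ..., [p_k] of the construction, [p :: ps]: each block
    starts on the chair that follows the final chair of the previous player.
    The last block is [e] chairs ahead of the first. *)
Fixpoint chain p ps e : Prop :=
  if ps is q :: ps' then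
    exists t e', [/\ seats p t, S q = ahead (S p) t.+1, chain q ps' e'
                   & e = t.+1 + e']
  else e = 0.

Lemma chain_last p ps e : chain p ps e -> S (last p ps) = ahead (S p) e.
Proof.
elim: ps p e => [|q ps IHps] p e /=; first by move->.
by move=> [t [e' [_ Sq /IHps -> ->]]]; rewrite Sq -aheadD.
Qed.

(** Until the last player of the chain is seated, the surplus of opening
    brackets does not fall below [depth p], since every player of the chain is
    seated no lower than the level at which his block opens. *)
Lemma chain_floor p ps e tz i :
    chain p ps e -> seats (last p ps) tz -> 0 < i <= (e + tz).+1 ->
  depth p + i <= load S (arc (S p) i).
Proof.
elim: ps p e i => [|q ps IHps] p e i /=; first by move=> -> /seats_le; apply.
move=> [t [e' [st Sq ch ->]]] sz /andP[i_gt0 lei].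
have [leit | lt_ti] := leqP i t.+1; first by apply: seats_le st _; rewrite i_gt0.
rewrite -(subnKC (ltnW lt_ti)) load_arcD -Sq.
have /seatsP[-> _] := st.
have := IHps q e' (i - t.+1) ch sz; rewrite subn_gt0 lt_ti /=.
by move=> /(_ ltac:(lia)); lia.
Qed.

(** By [chain_floor], a block of the chain that loses [p] loses nobody else
    before it meets the final chair of the last player: the surplus would have
    to fall below [depth p].  Hence the last loss is the one of the chain. *)
Lemma chain_distinguished p ps e tz fz fuel :
    chain p ps e -> seats (last p ps) tz -> fz = ahead (S p) (e + tz) ->
    e + tz < m -> e <= fuel ->
  distinguished rk S (last p ps) fz fuel (S p) =
    Some [seq (S q, q) | q <- p :: ps].
Proof.
elim: ps p e fuel => [|q ps IHps] p e fuel.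
  by move=> _ _ _ _ _; case: fuel => [|fuel] /=; rewrite eqxx.
move=> ch sz eqfz ltm lef.
have := chain_floor ch sz; have := chain_last ch.
case: ch => t [e' [st Sq ch eqe]] Sz floor; rewrite {1}eqe in lef.
case: fuel lef => // fuel lef.
have neq : S p != S (last p (q :: ps)).
  by rewrite Sz; apply/eqP => /(@aheadI _ (S p) 0 e) => /(_ _ _); lia.
rewrite [LHS]/= (negPf neq) eqfz cdist_ahead //.
rewrite (last_loss_seats _ (t := t) (p := p)) //; [| lia | lia |].
  rewrite -aheadS -Sq -eqfz (IHps _ e') //; [| lia | lia].
  by rewrite eqfz Sq -aheadD eqe addnA.
move=> q' t' /andP[ltt' lt'] Sq' st'.
have /seatsP[eqL ltL] := st'; have /seatsP[eqLp _] := st.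
have := ltL t.+1; rewrite Sq' eqLp => /(_ ltac:(lia)).
have := floor t'.+1; rewrite -Sq' eqL => /(_ ltac:(lia)).
by lia.
Qed.

(** If the block from [b] never runs out before the block of [z], consider the
    first chair at which the surplus of opening brackets is lowest between the
    two: a member of the block is seated there, and the chain goes on from the
    next chair, from which the surplus is again never negative. *)
Lemma chain_exists z b e : S z = ahead b e ->
    (forall i, 0 < i <= e -> i <= load S (arc b i)) ->
  exists p ps, [/\ S p = b, last p ps = z, chain p ps e
    & if e is 0 then p = z
      else exists2 i, 0 < i <= e & load S (arc b i) = depth p + i].
Proof.
have [N] := ubnP e; elim: N => // N IHN in b e *; rewrite ltnS.
case: e => [|e] leN Sz floor; first by exists z, [::].
have [f fE] : exists f : 'I_e.+1 -> nat,
  forall i : 'I_e.+1, f i = load S (arc b i.+1) - i.+1 by eexists.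
have [i0 _ mini] := @arg_minnP _ ord0 predT f isT.
have floor1 := floor 1 isT; rewrite load_arc1 in floor1.
have [|p Sp dp] := @depth_surj _ _ rk S b (f i0).
  apply: (leq_ltn_trans (mini ord0 isT)); by rewrite fE load_arc1 ltn_subrL.
have low i : 0 < i <= e.+1 -> depth p + i <= load S (arc b i).
  case: i => // i /andP[_ ltie]; have := mini (Ordinal ltie) isT.
  by have := floor i.+1 ltie; rewrite dp (fE (Ordinal ltie)) /=; lia.
have eqL : load S (arc b i0.+1) = depth p + i0.+1.
  by have := floor i0.+1 (ltn_ord i0); rewrite dp fE /=; lia.
have [|t let_i0 st] := @seats_exists _ _ rk S p i0; first by rewrite Sp eqL.
have lete : t < e.+1 := leq_ltn_trans let_i0 (ltn_ord i0).
have [|||q [ps [Sq eqz ch _]]] := IHN (ahead b t.+1) (e.+1 - t.+1).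
- lia.
- by rewrite -aheadD subnKC.
- move=> i /andP[i_gt0 lei]; have /seatsP[+ _] := st.
  by have := low (t.+1 + i); rewrite load_arcD Sp => /(_ ltac:(lia)); lia.
exists p, (q :: ps); split=> //; last by exists i0.+1; rewrite ?eqL //= ltn_ord.
by exists t, (e.+1 - t.+1); rewrite Sp Sq; split=> //; lia.
Qed.

(** [w] lists blocks, those of [p :: ps] and the others, in [r], such that
    each player of [p :: ps] but the last has his bracket closed right before
    the block of the next one. *)
Fixpoint spliced p ps r w : Prop :=
  if ps is q :: ps' then
    exists u r' w', [/\ r = u ++ r', w = S p :: u ++ w', closes p (S p :: u)
                      & spliced q ps' r' w']
  else w = S p :: r.

Lemma chain_spliced p ps e k :
  chain p ps e -> e < k -> exists r, spliced p ps r (arc (S p) k).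
Proof.
elim: ps p e k => [|q ps IHps] p e k /=.
  by case: k => // k _ _; exists (arc (ordS (S p)) k).
move=> [t [e' [st Sq ch ->]]] ltk.
have [|r' spl] := IHps q e' (k - t.+1) ch; first by lia.
exists (arc (ordS (S p)) t ++ r'), (arc (ordS (S p)) t), r', (arc (S q) (k - t.+1)).
split=> //; rewrite -{1}(subnKC (_ : t.+1 <= k)) ?arcD -?Sq //.
by lia.
Qed.

Lemma spliced_chain p ps r c k : spliced p ps r (arc c k) ->
  S p = c /\ exists2 e, e < k & chain p ps e.
Proof.
elim: ps p r c k => [|q ps IHps] p r c k /=.
  by case: k => //= k [-> _]; split=> //; exists 0.
move=> [u [r' [w' [_ eqw cl spl]]]].
have eqk : k = (size u).+1 + size w'.
  by rewrite -(size_traject (@ordS m) c k) -/(arc c k) eqw /= size_cat.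
move: eqw; rewrite eqk arcD -cat_cons => /eqP; rewrite eqseq_cat ?size_traject //.
case/andP=> /eqP equ /eqP eqw'; rewrite -eqw' in spl.
have [Sq [e' lte' ch]] := IHps _ _ _ _ spl.
have Sp : S p = c by case: equ.
split=> //; exists ((size u).+1 + e'); first by rewrite ltn_add2l.
by exists (size u), e'; rewrite /= Sp; split=> //; rewrite /seats Sp equ.
Qed.

Lemma spliced_perm p ps r w :
  spliced p ps r w -> perm_eq w ([seq S q | q <- p :: ps] ++ r).
Proof.
elim: ps p r w => [|q ps IHps] p r w; first by move=> /= ->.
move=> [u [r' [w' [-> -> _ /IHps eqw']]]]; rewrite map_cons cat_cons perm_cons.
by rewrite perm_sym perm_catCA perm_cat2l perm_sym.
Qed.

(** The other blocks are kept in their relative order. *)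
Lemma spliced_filter p ps r w : uniq w -> spliced p ps r w ->
  r = [seq x <- w | x \notin [seq S q | q <- p :: ps]].
Proof.
elim: ps p r w => [|q ps IHps] p r w.
  move=> + eqw; rewrite eqw cons_uniq => /andP[Sp_r _] /=.
  rewrite mem_seq1 eqxx /=; apply/esym/all_filterP/allP => x x_r.
  by rewrite mem_seq1; apply: contraNneq Sp_r => <-.
move=> Uw [u [r' [w' [-> eqw _ spl]]]]; move: Uw; rewrite eqw cons_uniq mem_cat.
rewrite negb_or cat_uniq => /andP[/andP[Sp_u Sp_w'] /and3P[_ /hasPn Duw' Uw']].
have sub x : x \in [seq S q | q <- q :: ps] -> x \in w'.
  by move=> xq; rewrite (perm_mem (spliced_perm spl)) mem_cat xq.
rewrite [LHS]/= map_cons [RHS]/= mem_head filter_cat; congr (_ ++ _).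
  apply/esym/all_filterP/allP => x x_u; rewrite in_cons negb_or.
  apply/andP; split; first by apply: contraNneq Sp_u => <-.
  by apply/negP => /sub /Duw' /negP.
rewrite (IHps _ _ _ Uw' spl); apply: eq_in_filter => x x_w'.
rewrite [in RHS]in_cons negb_or; case: eqP => // eqx.
by rewrite -eqx x_w' in Sp_w'.
Qed.

(** Were one prefix longer, the shorter one would end inside it, where the
    surplus still exceeds [depth p]. *)
Lemma closes_prefix p x u1 u2 r1 r2 :
    closes p (x :: u1) -> closes p (x :: u2) -> u1 ++ r1 = u2 ++ r2 ->
  u1 = u2 /\ r1 = r2.
Proof.
have main u u' r r' : closes p (x :: u) -> closes p (x :: u') ->
    u ++ r = u' ++ r' -> size u' <= size u.
  move=> [eqL _] [_ ltL] eqc; rewrite leqNgt; apply/negP => ltu.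
  have := ltL (size u).+1; rewrite /= !ltnS ltu => /(_ isT).
  have -> : take (size u) u' = u.
    by rewrite -(takel_cat r' (ltnW ltu)) -eqc take_size_cat.
  by rewrite eqL ltnn.
move=> cl1 cl2 eqc; have eqs : size u1 = size u2.
  by apply/eqP; rewrite eqn_leq (main u2 u1 r2 r1) // (main u1 u2 r1 r2).
by move/eqP: eqc; rewrite eqseq_cat // => /andP[/eqP-> /eqP->].
Qed.

Lemma spliced_inj p ps r w1 w2 :
  spliced p ps r w1 -> spliced p ps r w2 -> w1 = w2.
Proof.
elim: ps p r w1 w2 => [|q ps IHps] p r w1 w2 /=; first by move=> -> ->.
move=> [u1 [r1 [w1' [-> -> cl1 spl1]]]] [u2 [r2 [w2' [eqr -> cl2 spl2]]]].
have [equ eqr'] := closes_prefix cl1 cl2 eqr; subst u2 r2.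
by rewrite (IHps _ _ _ _ spl1 spl2).
Qed.

(** If the bracket of [p] were still open after all of [r], his block and those
    of [r] would hold more players than chairs; the blocks of [ps] are
    nonempty, so that players would outnumber chairs altogether. *)
Lemma spliced_exists p ps r :
    (load S ([seq S q | q <- p :: ps] ++ r) <= size (p :: ps) + size r) ->
  exists w, spliced p ps r w.
Proof.
elim: ps p r => [|q ps IHps] p r; first by exists (S p :: r).
have le_ps : size (q :: ps) <= load S [seq S q | q <- q :: ps].
  elim: (q :: ps) => //= q' s IHs; rewrite load_cons -add1n leq_add //.
  exact: leq_ltn_trans (depth_lt rk S q').
rewrite map_cons cat_cons load_cons load_cat => leL.
have [|i lei cl] := @closes_exists _ _ rk S p r.
  by rewrite load_cons; move: leL le_ps; rewrite /=; lia.
have [|w' spl] := IHps q (drop i r); last first.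
  exists (S p :: take i r ++ w'), (take i r), (drop i r), w'.
  by rewrite cat_take_drop.
have eqr : load S r = load S (take i r) + load S (drop i r).
  by rewrite -load_cat cat_take_drop.
have [eqL _] := cl; move: leL eqL; rewrite load_cons load_cat size_drop eqr.
by rewrite /= size_takel //; lia.
Qed.

End Chain.

Section Relabel.

Variables (m n : nat) (rk : 'S_n) (S T : sample m n) (f : 'I_m -> 'I_m).
Hypotheses (f_inj : injective f) (TE : forall p, T p = f (S p)).

Lemma relabel_block x : block T (f x) = block S x.
Proof. by apply/setP => p; rewrite !inE TE inj_eq. Qed.

Lemma relabel_load u : load T (map f u) = load S u.
Proof. by rewrite /load big_map; apply: eq_bigr => x _; rewrite relabel_block. Qed.

Lemma relabel_depth p : depth rk T p = depth rk S p.
Proof. by rewrite /depth TE relabel_block. Qed.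

Lemma relabel_spliced p ps r w :
  spliced rk S p ps r w -> spliced rk T p ps (map f r) (map f w).
Proof.
elim: ps p r w => [|q ps IHps] p r w /=; first by rewrite TE => ->.
move=> [u [r' [w' [-> -> [eqL ltL] /IHps spl]]]].
exists (map f u), (map f r'), (map f w'); rewrite TE /= !map_cat; split=> //.
rewrite -map_cons; split=> [|i]; rewrite ?size_map relabel_depth.
  by rewrite relabel_load.
by rewrite -map_take relabel_load; apply: ltL.
Qed.

End Relabel.

(** * Placing the blocks in a prescribed order *)

Section Place.

Variable m : nat.
Implicit Types (c x : 'I_m) (w : seq 'I_m).

(** The chair of the block [x] once the blocks are set down in the order [w],
    starting at [c]. *)
Definition place c w x : 'I_m := ahead c (index x w).

Lemma map_place c w : perm_eq w (arc c m) -> map (place c w) w = arc c m.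
Proof.
move=> eqw; have sz_w : size w = m by rewrite (perm_size eqw) size_traject.
apply: (@eq_from_nth _ c) => [|i]; first by rewrite size_map size_traject.
rewrite size_map sz_w => ltim; rewrite (nth_map c) ?sz_w //.
rewrite nth_traject // /place index_uniq ?sz_w //.
by rewrite (perm_uniq eqw) arc_uniq.
Qed.

Lemma place_inj c w : perm_eq w (arc c m) -> injective (place c w).
Proof.
move=> eqw; have sz_w : size w = m by rewrite (perm_size eqw) size_traject.
have ltx x : index x w < m by rewrite -{2}sz_w index_mem (perm_mem eqw) mem_arc.
move=> x y /(aheadI (ltx x) (ltx y)) eqi.
by rewrite -(nth_index c (_ : x \in w)) ?eqi ?nth_index ?(perm_mem eqw) ?mem_arc.
Qed.

(** Moving the blocks from the order [w] to the order of their chairs is undone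
    by reading the new names of the chairs in their former order. *)
Lemma placeK c w : perm_eq w (arc c m) ->
  cancel (place c w) (place c (map (place c w) (arc c m))).
Proof.
move=> eqw x; rewrite {1}/place index_map; last exact: place_inj.
exact: index_arcK.
Qed.

End Place.

(** * Patterns *)

Section Pattern.

Variables (m n : nat) (rk : 'S_n) (T : sample m n).
Hypothesis hmn : n <= m.
Implicit Types (a p q : 'I_n) (ps s : seq 'I_n) (c j : 'I_m).

(** The data that a match adds to its sample: the lower-ranked player [a] of
    the block of two, the higher-ranked one [p], and the others clockwise. *)
Definition marking a p ps : Prop :=
  [/\ uniq [:: a, p & ps], rk p < rk a
    & map T (p :: ps) = arc (T a) (size ps).+1].

(** In a match, the pattern is determined by its set of players. *)
Definition selection s : subsample m n :=
  [ffun q => if q \in s then Some (T q) else None].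

Lemma marking_size a p ps : marking a p ps -> (size ps).+2 <= n.
Proof.
by case=> /card_uniqP eqs _ _; rewrite -[leqRHS](card_ord n) -[leqLHS]eqs max_card.
Qed.

Lemma marking_head a p ps : marking a p ps -> T p = T a.
Proof. by case=> _ _ []. Qed.

Lemma make_patternE a p ps : marking a p ps ->
  make_pattern (T a) a (p :: ps) = selection [:: a, p & ps].
Proof.
move=> [_ _ eqT]; apply/ffunP => q; rewrite !ffunE [in RHS]in_cons.
case: eqP => [-> // | _] /=; case: ifP => // q_ps; congr Some.
have ltq : index q (p :: ps) < (size ps).+1 by rewrite index_mem.
by rewrite /ahead -(nth_traject _ ltq) -/(arc _ _) -eqT (nth_map q) // nth_index.
Qed.

Lemma card_selection s j : uniq s ->
  #|subblock (selection s) j| = count_mem j (map T s).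
Proof.
move=> Us; rewrite count_map -size_filter.
rewrite -(card_uniqP (filter_uniq _ Us)); apply: eq_card => q.
by rewrite !inE ffunE mem_filter /= andbC; case: (q \in s).
Qed.

Lemma marking_card a p ps j : marking a p ps ->
  #|subblock (selection [:: a, p & ps]) j|
    = (j == T a) + (j \in arc (T a) (size ps).+1).
Proof.
move=> mk; have [Us _ eqT] := mk; rewrite card_selection // map_cons eqT.
rewrite -[LHS]/((T a == j) + count_mem j (arc (T a) (size ps).+1)).
rewrite eq_sym count_uniq_mem //.
by rewrite arc_uniq // (leq_trans _ hmn) // ltnW // (marking_size mk).
Qed.

Lemma marking_pattern a p ps : marking a p ps ->
  is_pattern (size ps).+2 (selection [:: a, p & ps]).
Proof.
move=> mk; have [Us _ _] := mk; apply/and3P; split=> //.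
  have eqs : [set q | selection [:: a, p & ps] q] =i [:: a, p & ps].
    by move=> q; rewrite inE ffunE; case: ifP.
  by rewrite (eq_card eqs); apply/eqP/card_uniqP.
apply/existsP; exists (T a); apply/forallP => j; rewrite marking_card //.
rewrite in_cons !subSS subn0; case: (j == T a) => //.
Qed.

Lemma matches_selection s : sample_matches T (selection s).
Proof.
apply/forallP => j; apply/subsetP => q; rewrite !inE ffunE.
by case: ifP => // _ /eqP[->].
Qed.

(** The block of two is the only one with two selected players, their ranks
    tell [a] from [p], and the others are ordered by their chairs. *)
Lemma marking_inj a p ps a' p' ps' :
    marking a p ps -> marking a' p' ps' ->
    selection [:: a, p & ps] = selection [:: a', p' & ps'] ->
  [/\ a = a', p = p' & ps = ps'].
Proof.
move=> mk mk' eqsel.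
have eqs : [:: a, p & ps] =i [:: a', p' & ps'].
  move=> q; move/ffunP/(_ q): eqsel; rewrite !ffunE.
  by case: ifP; case: ifP.
have [[Us lt_pa eqT] [Us' lt_pa' eqT']] := (mk, mk').
have /eqP eqsz : (size ps).+2 == (size ps').+2.
  by rewrite -[_ == _]/(size [:: a, p & ps] == size [:: a', p' & ps']) eqn_leq
     !uniq_leq_size // => q; rewrite eqs.
have {}eqsz : size ps = size ps' by case: eqsz.
have eqc : T a = T a'.
  have := marking_card (T a) mk; rewrite eqsel marking_card // eqxx mem_head.
  by case: eqP => // _; case: (_ \in _).
rewrite -eqc -eqsz in eqT'.
have Uarc : uniq (arc (T a) (size ps).+1).
  by rewrite arc_uniq // (leq_trans _ hmn) // ltnW // (marking_size mk).
(* the block at c has the members a and p, and p is the higher-ranked one *)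
have block_c q : q \in [:: a, p & ps] -> T q = T a -> q = a \/ q = p.
  rewrite !in_cons => /or3P[/eqP-> | /eqP-> | q_ps] Tq; try by [left | right].
  move: Uarc; rewrite -eqT /= (marking_head mk) -Tq => /andP[/negP[]].
  exact: map_f.
have [eqa eqp] : a = a' /\ p = p'.
  have Ta' : T a' = T a by [].
  have Tp' : T p' = T a by rewrite (marking_head mk').
  have a'in : a' \in [:: a, p & ps] by rewrite eqs mem_head.
  have p'in : p' \in [:: a, p & ps] by rewrite eqs !in_cons eqxx orbT.
  have [] := block_c _ a'in Ta'; have [] := block_c _ p'in Tp' => eqp' eqa'.
  - by move: lt_pa'; rewrite eqp' eqa' ltnn.
  - by [].
  - by move: lt_pa'; rewrite eqp' eqa' ltnNge ltnW.
  - by move: lt_pa'; rewrite eqp' eqa' ltnn.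
subst a' p'; split=> //.
have Tinj : {in p :: ps &, injective T}.
  move=> q1 q2 q1in q2in eqTq; have := Uarc; rewrite -eqT => UT.
  have := nth_uniq (T a) _ _ UT; rewrite size_map => nu.
  have i1 : index q1 (p :: ps) < size (p :: ps) by rewrite index_mem.
  have i2 : index q2 (p :: ps) < size (p :: ps) by rewrite index_mem.
  have := nu _ _ i1 i2; rewrite !(nth_map p) // !nth_index // eqTq eqxx.
  by move=> /esym/eqP eqi; rewrite -(nth_index p q1in) eqi nth_index.
have eqps : p :: ps =i p :: ps'.
  move=> q; have := eqs q; rewrite !(in_cons a).
  case: eqP => [-> _ | _ //].
  move: Us Us'; rewrite !(cons_uniq a) => /andP[/negPf -> _].
  by case/andP=> /negPf ->.
suff [] : p :: ps = p :: ps' by [].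
apply: (inj_in_map Tinj); last by rewrite eqT eqT'.
  by rewrite inE; apply/allP.
by rewrite inE; apply/allP => q; rewrite -eqps.
Qed.

Lemma match_marking k (P : subsample m n) : k <= n ->
    is_pattern k P -> sample_matches T P ->
  exists a p ps, marking a p ps /\ P = selection [:: a, p & ps].
Proof.
move=> lekn /and3P[k_ge2 _ /existsP[c /forallP card_c]] /forallP matchP.
have TP q j : P q = Some j -> T q = j.
  move=> Pq; have := subsetP (matchP j) q; rewrite !inE Pq eqxx.
  by move=> /(_ isT)/eqP.
case: k k_ge2 lekn card_c => [|[|k]] // _ lekn card_c.
rewrite !subSS subn0 in card_c.
have [a [p [lt_pa subc]]] : exists a p, rk p < rk a /\ subblock P c = [set a; p].
  have := card_c c; rewrite eqxx => /cards2P[x [y [ne_xy eqxy]]].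
  case: (ltngtP (rk x) (rk y)) => [ltxy | ltyx | eqr].
  - by exists y, x; rewrite eqxy setUC.
  - by exists x, y.
  - by move: ne_xy; rewrite (perm_inj (ord_inj eqr)) eqxx.
have Pc q : (P q == Some c) = (q == a) || (q == p).
  by have /setP/(_ q) := subc; rewrite !inE.
have Pa : P a = Some c by apply/eqP; rewrite Pc eqxx.
have Pp : P p = Some c by apply/eqP; rewrite Pc eqxx orbT.
have Uarc : uniq (arc c k.+1) by apply: arc_uniq; lia.
have [c_arc Uarc'] : c \notin arc (ordS c) k /\ uniq (arc (ordS c) k).
  exact/andP.
pose g j := odflt a [pick q in subblock P j].
have subg j : j \in arc (ordS c) k -> subblock P j = [set g j].
  move=> j_arc; have := card_c j; rewrite (negPf (_ : j != c)); last first.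
    by apply: contraNneq c_arc => eqj; rewrite -{1}eqj.
  rewrite j_arc => /cards1P[q eqq]; rewrite /g eqq; case: pickP => [q'|/(_ q)].
    by rewrite inE => /eqP ->.
  by rewrite inE eqxx.
have Pg j : j \in arc (ordS c) k -> P (g j) = Some j.
  by move=> /subg/setP/(_ (g j)); rewrite !inE eqxx => /eqP.
pose ps := map g (arc (ordS c) k).
have Tps : map T ps = arc (ordS c) k.
  rewrite -map_comp -[RHS]map_id; apply/eq_in_map => j /Pg.
  exact: TP.
have Pps q : q \in ps -> P q = Some (T q).
  by case/mapP=> j j_arc ->; rewrite Pg //; congr Some; rewrite (TP _ j) ?Pg.
have notc q : q \in ps -> T q != c.
  by move=> q_ps; apply: contraNneq c_arc => eqTq; rewrite -Tps -eqTq map_f.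
exists a, p, ps; split.
  split=> //.
    have Ups : uniq ps by apply: (@map_uniq _ _ T); rewrite Tps.
    rewrite /= Ups andbT in_cons negb_or -andbA; apply/and3P; split.
    - by apply: contraTneq lt_pa => ->; rewrite ltnn.
    - by apply/negP => /notc; rewrite (TP _ _ Pa) eqxx.
    - by apply/negP => /notc; rewrite (TP _ _ Pp) eqxx.
  by rewrite map_cons Tps (TP _ _ Pa) (TP _ _ Pp) size_map size_traject.
apply/ffunP => q; rewrite ffunE !in_cons orbA -Pc.
case: (P q =P Some c) => [Pq | nePq] /=; first by rewrite Pq (TP _ _ Pq).
case: ifP => [/Pps // | /negbT q_ps]; case Pq: (P q) => [j|] //.
have q_j : q \in subblock P j by rewrite inE Pq.
have [j_arc | j_arc] := boolP (j \in arc (ordS c) k).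
  by move: q_j q_ps; rewrite (subg _ j_arc) inE => /eqP ->; rewrite map_f.
have := card_c j; rewrite (negPf j_arc); case: (j =P c) => [eqj | _].
  by rewrite -eqj Pq in nePq.
by rewrite cards_eq0 => /eqP j0; rewrite j0 inE in q_j.
Qed.

End Pattern.

(** * The correspondence *)

Section Correspondence.

Variables (m n : nat) (rk : 'S_n).
Hypothesis hmn : n <= m.
Implicit Types (S T : sample m n) (a p q z : 'I_n) (ps : seq 'I_n) (c : 'I_m).

(** The rejections of the form (S, a, last p ps), with [p :: ps] the players
    of the construction. *)
Definition linked S a p ps : Prop :=
  [/\ S p = S a, rk p < rk a & exists2 e, e < m & chain rk S p ps e].

(** The chain starts above [a]: as his bracket stays open, the surplus of
    opening brackets exceeds [depth a] until he is seated, in particular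
    where the first player of the chain is seated. *)
Lemma rejection_linked S a z : is_rejection rk S a z ->
  exists p ps, linked S a p ps /\ z = last p ps.
Proof.
move=> /rejectionP-/(_ hmn)[e [tz [ta [sz sa lttam Sz lte]]]].
have ltem : e < m by lia.
have /seatsP[eqLa ltLa] := sa.
have [i|p [ps [Sp eqz ch low]]] := chain_exists rk Sz.
  by move=> /andP[i_gt0 lei]; have := ltLa i; lia.
exists p, ps; split=> //; split=> //; last by exists e.
rewrite ltnNge -(@depth_le _ _ rk S) // -ltnNge.
case: e low lte {Sz ltem ch} => [eqpz lte | e [i /andP[i_gt0 lei] eqL] lte].
  have /seatsP[eqLz _] := sz; rewrite -(ltn_add2r tz.+1) eqpz -eqLz -eqpz Sp.
  by have := ltLa tz.+1; lia.
by have := ltLa i; rewrite eqL; lia.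
Qed.

(** By [chain_floor] the surplus stays at least [depth p], which exceeds
    [depth a], until the last player of the chain is seated. *)
Lemma linked_nested S a p ps : linked S a p ps ->
  exists e tz ta, [/\ seats rk S (last p ps) tz, seats rk S a ta, ta < m,
    chain rk S p ps e & e + tz < ta].
Proof.
move=> [Sp lt_pa [e lte ch]].
have [tz ltz sz] := @seats_exists_lt _ _ rk S (last p ps) hmn.
have [ta lta sa] := @seats_exists_lt _ _ rk S a hmn.
exists e, tz, ta; split=> //; rewrite ltnNge; apply/negP => le_ta.
have := chain_floor (i := ta.+1) ch sz le_ta.
have /seatsP[+ _] := sa; rewrite Sp => ->.
by rewrite leq_add2r depth_le // leqNgt lt_pa.
Qed.

Lemma linked_rejection S a p ps : linked S a p ps ->
  is_rejection rk S a (last p ps).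
Proof.
move=> lk; have [e [tz [ta [sz sa lta ch lte]]]] := linked_nested lk.
have [Sp _ _] := lk; apply/rejectionP => //; exists e, tz, ta; split=> //.
by rewrite (chain_last ch) Sp.
Qed.

Lemma linked_map S a p ps : linked S a p ps ->
  rejection_map rk (S, a, last p ps) =
    Some (rearrange S (S a) (map S (p :: ps)), make_pattern (S a) a (p :: ps)).
Proof.
move=> lk; have [e [tz [ta [sz sa lta ch lte]]]] := linked_nested lk.
have [Sp _ _] := lk.
have fz : final_chair rk S (last p ps) = Some (ahead (S p) (e + tz)).
  apply/final_chairP; exists tz; first by lia.
  by split=> //; rewrite aheadD (chain_last ch).
rewrite /rejection_map fz -Sp (chain_distinguished (e := e) (tz := tz)) //; try lia.
by rewrite /unzip1 /unzip2 -!map_comp map_id.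
Qed.

Lemma rearrangeE S c bs q :
  rearrange S c bs q = place c (block_order c bs) (S q).
Proof. by rewrite ffunE. Qed.

(** In the rearranged sample the distinguished blocks come first, and the
    order in which the blocks stood is a splicing of them with the others. *)
Lemma linked_marking S a p ps (c := S a) (w := block_order c (map S (p :: ps)))
    (T := rearrange S c (map S (p :: ps))) :
  linked S a p ps ->
  [/\ T a = c, marking rk T a p ps, perm_eq w (arc c m)
    & spliced rk T p ps (drop (size ps).+1 (arc c m)) (map (place c w) (arc c m))].
Proof.
move=> [Sp lt_pa [e lte ch]]; have [r spl] := chain_spliced ch lte.
have Uarc := arc_uniq c (leqnn m).
rewrite Sp -/c in spl; have eqr := spliced_filter Uarc spl.
have eqw : perm_eq w (arc c m).
  by rewrite /w /block_order -/(arc c m) -eqr perm_sym (spliced_perm spl).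
have finj := place_inj eqw.
have TE q : T q = place c w (S q) by apply: rearrangeE.
have eqmap := map_place eqw.
have wE : w = map S (p :: ps) ++ r by rewrite eqr.
have Ta : T a = c by rewrite TE /place wE /= Sp eqxx.
have ltk : (size ps).+1 <= m.
  have := perm_size eqw; rewrite wE size_cat size_map size_traject => <-.
  exact: leq_addr.
have eqcat : map T (p :: ps) ++ map (place c w) r = arc c m.
  by rewrite (eq_map (TE : T =1 place c w \o S)) map_comp -map_cat -wE.
have eqT : map T (p :: ps) = arc c (size ps).+1.
  rewrite /arc -(take_traject _ _ ltk) -/(arc c m) -eqcat.
  by rewrite take_size_cat ?size_map.
have eqdrop : map (place c w) r = drop (size ps).+1 (arc c m).
  by rewrite -eqcat drop_size_cat ?size_map.
split=> //; last by rewrite -eqdrop; apply: relabel_spliced.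
rewrite /marking Ta; split=> //.
have UT : uniq (map T (p :: ps)) by rewrite eqT arc_uniq.
have Us := map_uniq UT; rewrite cons_uniq Us andbT in_cons negb_or.
apply/andP; split; first by apply: contraTneq lt_pa => ->; rewrite ltnn.
move: UT; rewrite map_cons cons_uniq => /andP[+ _]; apply: contra => a_ps.
by rewrite TE Sp -TE map_f.
Qed.

Lemma rejection_map_in_matches S a z : is_rejection rk S a z ->
  exists2 q, q \in matches m n & rejection_map rk (S, a, z) = Some q.
Proof.
case/rejection_linked=> p [ps [lk ->]]; rewrite (linked_map lk).
have [Ta mk _ _] := linked_marking lk; move: Ta mk.
set T := rearrange _ _ _ => Ta mk; rewrite -{1}Ta (make_patternE mk).
eexists; last by []; rewrite inE matches_selection andbT /=.
have ltk : (size ps).+2 < n.+1 by rewrite ltnS (marking_size mk).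
by apply/existsP; exists (Ordinal ltk); apply: marking_pattern mk.
Qed.

(** The match determines [a] and the players of the chain, thus also the only
    possible splicing of the blocks, from which the sample is read off. *)
Lemma rejection_map_inj S1 a1 z1 S2 a2 z2 :
    is_rejection rk S1 a1 z1 -> is_rejection rk S2 a2 z2 ->
    rejection_map rk (S1, a1, z1) = rejection_map rk (S2, a2, z2) ->
  (S1, a1, z1) = (S2, a2, z2).
Proof.
move=> /rejection_linked[p1 [ps1 [lk1 ->]]] /rejection_linked[p2 [ps2 [lk2 ->]]].
rewrite (linked_map lk1) (linked_map lk2) => -[eqT eqP].
have [] := linked_marking lk1; have [] := linked_marking lk2.
rewrite -eqT; move: (rearrangeE S1 (S1 a1) (map S1 (p1 :: ps1))).
move: (rearrangeE S2 (S2 a2) (map S2 (p2 :: ps2))); rewrite -eqT.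
move: (rearrange _ _ _) => T TE2 TE1 Ta2 mk2 eqw2 spl2 Ta1 mk1 eqw1 spl1.
rewrite -{1}Ta1 -{1}Ta2 (make_patternE mk1) (make_patternE mk2) in eqP.
have [eqa eqp eqps] := marking_inj hmn mk1 mk2 eqP; subst a2 p2 ps2.
rewrite -Ta2 Ta1 in TE2 eqw2 spl2.
have eqmap := spliced_inj spl1 spl2.
congr (_, _, _); apply/ffunP => q.
by rewrite -(placeK eqw1 (S1 q)) -TE1 eqmap TE2 placeK.
Qed.

(** The sample is obtained by setting down the blocks of [T] in the spliced
    order. *)
Lemma rejection_map_onto T (P : subsample m n) : (T, P) \in matches m n ->
  exists S a z, is_rejection rk S a z /\ rejection_map rk (S, a, z) = Some (T, P).
Proof.
rewrite inE => /andP[/existsP[k /= patP] matchP].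
have [|a [p [ps [mk eqP]]]] := match_marking rk hmn _ patP matchP.
  by rewrite -ltnS.
have [_ lt_pa eqT] := mk; pose c := T a.
have ltk : (size ps).+1 <= m by have := marking_size mk; lia.
pose r := drop (size ps).+1 (arc c m).
have eqarc : map T (p :: ps) ++ r = arc c m.
  by rewrite eqT /r /arc -(take_traject _ _ ltk) cat_take_drop.
have [|w spl] := @spliced_exists _ _ rk T p ps r.
  rewrite eqarc load_circle /r size_drop size_traject /=; lia.
have eqw : perm_eq w (arc c m) by rewrite -eqarc (spliced_perm spl).
have eqmap := map_place eqw.
pose S : sample m n := [ffun q => place c w (T q)].
have SE q : S q = place c w (T q) by rewrite ffunE.
have := relabel_spliced (place_inj eqw) SE spl; rewrite eqmap => splS.
have [Sp [e lte ch]] := spliced_chain splS.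
have Sa : S a = c by rewrite SE -(marking_head mk) -SE.
have lk : linked S a p ps by split; [rewrite Sp Sa | | exists e].
exists S, a, (last p ps); split; first exact: linked_rejection.
apply: etrans (linked_map lk) _; rewrite Sa (make_patternE mk) -eqP; congr (Some (_, _)).
apply/ffunP => q; rewrite rearrangeE SE /block_order.
rewrite -[traject _ c m]/(arc c m) -(spliced_filter (arc_uniq c (leqnn m)) splS).
have -> : map S (p :: ps) = map (place c w) (map T (p :: ps)).
  by rewrite -map_comp; apply: eq_map.
by rewrite -map_cat eqarc placeK.
Qed.

End Correspondence.

Unset Implicit Arguments.

(* The image is taken among options: the equality below also says that the    *)
(* construction succeeds on every rejection.                                  *)
Theorem mainTheorem2 (m n : nat) (rk : 'S_n) (hn : 1 <= n) (hmn : n <= m) :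
  {in rejections m rk &, injective (@rejection_map m n rk)} /\
  [set rejection_map rk r | r in rejections m rk] =
    [set Some q | q in matches m n].
Proof.
split=> [[[S1 a1] z1] [[S2 a2] z2] | ].
  by rewrite !inE; apply: rejection_map_inj.
apply/setP => o; apply/imsetP/imsetP => [[[[S a] z]] | [[T P] matchTP ->]].
  rewrite inE => rej ->; have [q matchq eqq] := rejection_map_in_matches hmn rej.
  by exists q.
have [S [a [z [rej eqq]]]] := rejection_map_onto rk hmn matchTP.
by exists (S, a, z); rewrite ?inE.
Qed.
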